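(* Let $p$ be a prime and let $G$ be a finite-rank torsion-free abelian group. Let $D$ be the divisible subgroup of $G\otimes\mathbb{Z}_p$. Then there is a continuous isomorphism between $G^{*p*p}$ and $(G\otimes\mathbb{Z}_p)/D$ that sends $\hat g$ to $g\otimes 1+D$ for all $g\in G$.
   Context: The rank of a torsion-free abelian group is the size of any maximal linearly independent (over $\mathbb{Z}$) subset. The tensor product is over $\mathbb{Z}$, and the divisible subgroup of an abelian group is its largest divisible subgroup. For an abelian group $H$, $H^{*p}=\mathrm{Hom}(H,\mathbb{Z}_p)$ is the group of group homomorphisms from $H$ to the $p$-adic integers. The $p$-adic double dual is $G^{*p*p}=(G^{*p})^{*p}=\mathrm{Hom}(G^{*p},\mathbb{Z}_p)$, and for $g\in G$ the element $\hat g\in G^{*p*p}$ is the image of $g$ under the natural (evaluation) homomorphism, $\hat g(\phi)=\phi(g)$ for $\phi\in G^{*p}$. Both $G^{*p*p}$ and $(G\otimes\mathbb{Z}_p)/D$ are free $\mathbb{Z}_p$-modules of finite $\mathbb{Z}_p$-rank; each carries its $p$-adic topology (which agrees with its pro-$p$ topology), and continuity is with respect to these topologies. *)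

(* Defs.v *)
From HB Require Import structures.
From mathcomp Require Import all_boot all_order all_algebra ring_quotient.
From mathcomp Require Import boolp classical_sets filter topology.
From mathcomp.multinomials Require Import freeg.

Set Implicit Arguments.
Unset Strict Implicit.
Unset Printing Implicit Defensive.

Import Order.TTheory GRing.Theory Num.Theory.
Local Open Scope ring_scope.
Local Open Scope quotient_scope.

Definition torsion_free (G : zmodType) : Prop :=
  forall (g : G) (n : nat), g *+ n = 0 -> n = 0%N \/ g = 0.

Definition lin_indep (G : zmodType) (s : seq G) : Prop :=
  forall c : 'I_(size s) -> int,
    \sum_(i < size s) s`_i *~ c i = 0 -> forall i, c i = 0.

(* Independence is a condition on families, so a list with a repeated entry is
   dependent and [lin_indep (g :: s)] fails automatically when [g \in s]. *)
Definition max_lin_indep (G : zmodType) (s : seq G) : Prop :=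
  lin_indep s /\ forall g : G, ~ lin_indep (g :: s).

Definition has_rank (G : zmodType) (r : nat) : Prop :=
  exists s : seq G, max_lin_indep s /\ size s = r.

Definition finite_rank (G : zmodType) : Prop := exists r : nat, has_rank G r.

Section Subgroups.
Variable V : zmodType.

Definition generated_subgroup (X : set V) : {pred V} :=
  fun v => `[< forall S : {pred V}, zmod_closed S ->
                 (forall x, X x -> x \in S) -> v \in S >].

Fact generated_subgroup_zmod_closed (X : set V) :
  zmod_closed (generated_subgroup X).
Proof.
split=> [|u v /asboolP Hu /asboolP Hv]; apply/asboolP => S cS XS.
  by case: cS.
by case: (cS) => _; apply; [exact: Hu | exact: Hv].
Qed.

HB.instance Definition _ (X : set V) :=
  GRing.isZmodClosed.Build V (generated_subgroup X)
    (generated_subgroup_zmod_closed X).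

Definition divisible (S : {pred V}) : Prop :=
  forall (n : nat) (x : V), (0 < n)%N -> x \in S ->
    exists2 y, y \in S & y *+ n = x.

Definition divisible_subgroup : {pred V} :=
  fun v => `[< exists S : {pred V}, [/\ zmod_closed S, divisible S & v \in S] >].

Fact divisible_subgroup_zmod_closed : zmod_closed divisible_subgroup.
Proof.
split=> [|u v /asboolP[S [[S0 SB] dS Su]] /asboolP[T [[T0 TB] dT Tv]]].
  apply/asboolP; exists (fun w => w == 0); split; last exact: eqxx.
    by split=> [|x y]; rewrite !unfold_in ?eqxx // => /eqP-> /eqP->; rewrite subr0.
  by move=> n x n0; rewrite unfold_in => /eqP->; exists 0; rewrite ?unfold_in ?mul0rn.
apply/asboolP.
exists (fun w => `[< exists x y, [/\ x \in S, y \in T & w = x - y] >]); split.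
- split; first by apply/asboolP; exists 0, 0; rewrite subr0.
  move=> _ _ /asboolP[x [y [Sx Ty ->]]] /asboolP[x' [y' [Sx' Ty' ->]]].
  apply/asboolP; exists (x - x'), (y - y'); split; [exact: SB|exact: TB|].
  by rewrite !opprB [y' - x']addrC addrACA [- y + _]addrC.
- move=> n _ n0 /asboolP[x [y [Sx Ty ->]]].
  have [x' Sx' <-] := dS n x n0 Sx; have [y' Ty' <-] := dT n y n0 Ty.
  exists (x' - y'); last by rewrite mulrnBl.
  by apply/asboolP; exists x', y'.
- by apply/asboolP; exists u, v.
Qed.

HB.instance Definition _ :=
  GRing.isZmodClosed.Build V divisible_subgroup divisible_subgroup_zmod_closed.

Fact divisible_subgroup_divisible : divisible divisible_subgroup.
Proof.
move=> n x n0 /asboolP[S [cS dS Sx]]; have [y Sy <-] := dS n x n0 Sx.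
by exists y => //; apply/asboolP; exists S.
Qed.

Fact divisible_subgroup_max (S : {pred V}) : zmod_closed S -> divisible S ->
  {subset S <= divisible_subgroup}.
Proof. by move=> cS dS x Sx; apply/asboolP; exists S. Qed.

End Subgroups.

Section Hom.
Variables A B : zmodType.
Implicit Types f g h : {additive A -> B}.

HB.instance Definition _ := gen_eqMixin {additive A -> B}.
HB.instance Definition _ := gen_choiceMixin {additive A -> B}.

Fact additive_ext f g : f =1 g -> f = g.
Proof.
case: f g => [f [[mf]]] [g [[mg]]] /= /funext fg; subst g.
by rewrite (Prop_irrelevance mf mg).
Qed.

Definition hom_zero : {additive A -> B} := \0.
Definition hom_opp f : {additive A -> B} := \- f.
Definition hom_add f g : {additive A -> B} := f \+ g.

Fact hom_addA : associative hom_add.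
Proof. by move=> f g h; apply: additive_ext => x; exact: addrA. Qed.

Fact hom_addC : commutative hom_add.
Proof. by move=> f g; apply: additive_ext => x; exact: addrC. Qed.

Fact hom_add0 : left_id hom_zero hom_add.
Proof. by move=> f; apply: additive_ext => x; exact: add0r. Qed.

Fact hom_addN : left_inverse hom_zero hom_opp hom_add.
Proof. by move=> f; apply: additive_ext => x; exact: addNr. Qed.

HB.instance Definition _ :=
  GRing.isZmodule.Build {additive A -> B} hom_addA hom_addC hom_add0 hom_addN.

End Hom.

Section PadicIntegers.
Variable p : nat.

(* [x] is the sequence of the canonical residues of a p-adic integer modulo
   [p ^ n]; when [p > 0] the equations also force [0 <= x n < p ^ n]. *)
Record padic_int : Type := PadicInt {
  padic_res :> nat -> int;
  padic_resP : forall n, padic_res n = (padic_res n.+1 %% (p%:Z ^+ n))%Z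
}.

HB.instance Definition _ := gen_eqMixin padic_int.
HB.instance Definition _ := gen_choiceMixin padic_int.

Implicit Types x y z : padic_int.

Fact padic_ext x y : x =1 y -> x = y.
Proof.
case: x y => [x px] [y py] /= /funext xy; subst y.
by rewrite (Prop_irrelevance px py).
Qed.

Fact padic_res_mod x n : (x n %% (p%:Z ^+ n))%Z = x n.
Proof. by rewrite padic_resP modz_mod. Qed.

Fact padic_res_succ (a : nat -> int) :
  (forall n, (a n.+1 = a n %[mod p%:Z ^+ n])%Z) ->
  forall n, (a n %% (p%:Z ^+ n))%Z =
            ((a n.+1 %% (p%:Z ^+ n.+1))%Z %% (p%:Z ^+ n))%Z.
Proof.
move=> ha n; rewrite -ha; apply/eqP.
rewrite eqz_mod_dvd {1}(divz_eq (a n.+1) (p%:Z ^+ n.+1)) addrK.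
by rewrite dvdz_mull // dvdz_exp2l.
Qed.

Fact padic_res_eqm x n : (x n.+1 = x n %[mod p%:Z ^+ n])%Z.
Proof. by rewrite [x n]padic_resP modz_mod. Qed.

Definition padic_make (a : nat -> int)
    (ha : forall n, (a n.+1 = a n %[mod p%:Z ^+ n])%Z) : padic_int :=
  @PadicInt (fun n => (a n %% (p%:Z ^+ n))%Z) (padic_res_succ ha).

Fact padic_const_subproof (c : int) n : (c = c %[mod p%:Z ^+ n])%Z.
Proof. by []. Qed.

Fact padic_opp_subproof x n : (- x n.+1 = - x n %[mod p%:Z ^+ n])%Z.
Proof. by rewrite -modzNm padic_res_eqm modzNm. Qed.

Fact padic_add_subproof x y n :
  (x n.+1 + y n.+1 = x n + y n %[mod p%:Z ^+ n])%Z.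
Proof. by rewrite -modzDm !padic_res_eqm modzDm. Qed.

Fact padic_mul_subproof x y n :
  (x n.+1 * y n.+1 = x n * y n %[mod p%:Z ^+ n])%Z.
Proof. by rewrite -modzMm !padic_res_eqm modzMm. Qed.

Definition padic_zero := padic_make (padic_const_subproof 0).
Definition padic_one := padic_make (padic_const_subproof 1).
Definition padic_opp x := padic_make (padic_opp_subproof x).
Definition padic_add x y := padic_make (padic_add_subproof x y).
Definition padic_mul x y := padic_make (padic_mul_subproof x y).

Fact padic_addA : associative padic_add.
Proof.
by move=> x y z; apply: padic_ext => n /=; rewrite modzDmr modzDml addrA.
Qed.

Fact padic_addC : commutative padic_add.
Proof. by move=> x y; apply: padic_ext => n /=; rewrite addrC. Qed.

Fact padic_add0 : left_id padic_zero padic_add.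
Proof.
by move=> x; apply: padic_ext => n /=; rewrite modzDml add0r padic_res_mod.
Qed.

Fact padic_addN : left_inverse padic_zero padic_opp padic_add.
Proof. by move=> x; apply: padic_ext => n /=; rewrite modzDml addNr. Qed.

HB.instance Definition _ := GRing.isZmodule.Build padic_int
  padic_addA padic_addC padic_add0 padic_addN.

Fact padic_mulA : associative padic_mul.
Proof.
by move=> x y z; apply: padic_ext => n /=; rewrite modzMmr modzMml mulrA.
Qed.

Fact padic_mulC : commutative padic_mul.
Proof. by move=> x y; apply: padic_ext => n /=; rewrite mulrC. Qed.

Fact padic_mul1 : left_id padic_one padic_mul.
Proof.
by move=> x; apply: padic_ext => n /=; rewrite modzMml mul1r padic_res_mod.
Qed.

Fact padic_mulDl : left_distributive padic_mul +%R.
Proof.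
by move=> x y z; apply: padic_ext => n /=; rewrite modzMml modzDm mulrDl.
Qed.

HB.instance Definition _ := GRing.Zmodule_isComPzRing.Build padic_int
  padic_mulA padic_mulC padic_mul1 padic_mulDl.

End PadicIntegers.

Section Tensor.
Variables A B : zmodType.

Definition bilinear_relations : set {freeg (A * B)} :=
  [set r | (exists a a' b, r = << (a + a', b) >> - << (a, b) >> - << (a', b) >>)
        \/ (exists a b b', r = << (a, b + b') >> - << (a, b) >> - << (a, b') >>)].

Definition tensor : Type := Quotient.quot (generated_subgroup bilinear_relations).

HB.instance Definition _ := GRing.Zmodule.on tensor.

Definition tens (a : A) (b : B) : tensor := \pi_tensor << (a, b) >>.

End Tensor.

Definition mod_div (V : zmodType) : Type :=
  Quotient.quot (@divisible_subgroup V).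

HB.instance Definition _ (V : zmodType) := GRing.Zmodule.on (mod_div V).

(* A copy of [V] carrying the topology in which the subgroups [p ^ n V] form a
   fundamental system of neighbourhoods of 0. *)
Definition padic_space (p : nat) (V : zmodType) : Type := V.

HB.instance Definition _ (p : nat) (V : zmodType) :=
  GRing.Zmodule.on (padic_space p V).

Section PadicTopology.
Variables (p : nat) (V : zmodType).

Definition padic_open (U : set (padic_space p V)) : Prop :=
  forall x, U x ->
    exists n : nat, forall v : padic_space p V, U (x + v *+ p ^ n).

Fact padic_openT : padic_open setT.
Proof. by move=> x _; exists 0%N. Qed.

Fact padic_openI : setI_closed padic_open.
Proof.
move=> U W oU oW x [Ux Wx].
have [m Um] := oU x Ux; have [n Wn] := oW x Wx.
exists (m + n)%N => v; split; rewrite expnD.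
  by rewrite mulnC mulrnA; exact: Um.
by rewrite mulrnA; exact: Wn.
Qed.

Fact padic_open_bigU (I : Type) (F : I -> set (padic_space p V)) :
  (forall i, padic_open (F i)) -> padic_open (\bigcup_i F i)%classic.
Proof.
move=> oF x [i _ Fix]; have [n Fn] := oF i x Fix.
by exists n => v; exists i => //; exact: Fn.
Qed.

HB.instance Definition _ := isOpenTopological.Build (padic_space p V)
  padic_openT padic_openI padic_open_bigU.

End PadicTopology.

Notation "A ^*[ p ]" := {additive A -> padic_int p}
  (at level 2, left associativity, format "A ^*[ p ]") : type_scope.

Section Evaluation.
Variables (p : nat) (G : zmodType) (g : G).

Definition hat_fun (phi : G^*[p]) : padic_int p := phi g.

Fact hat_is_zmod_morphism : zmod_morphism hat_fun.
Proof. by []. Qed.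

HB.instance Definition _ :=
  GRing.isZmodMorphism.Build G^*[p] (padic_int p) hat_fun hat_is_zmod_morphism.

Definition hat : G^*[p]^*[p] := hat_fun.

End Evaluation.

(* Main.v *)
From HB Require Import structures.
Require Import Defs.
From mathcomp Require Import all_boot all_order all_algebra ring_quotient.
From mathcomp Require Import boolp classical_sets filter topology.
From mathcomp.multinomials Require Import freeg.

(** Choose [e_1, ..., e_k] in [G] whose classes form a basis of [G / pG].  Since
    [G] is torsion-free, elements independent modulo [p] are independent over
    the integers, so [k] is at most the rank of [G] and such a maximal family
    exists ([exists_p_basis]).  Dividing repeatedly by [p], every element of [G]
    is, for each [n], an integral combination of the [e_i] up to [p ^ n G], and
    the coefficients are unique modulo [p ^ n].  As [n] grows they converge to
    [p]-adic coordinates, that is to homomorphisms [phi_i : G -> Z_p] with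
    [phi_i (e_j) = delta_ij] ([exists_dual_basis]).

    Because [Z_p] has no nonzero element divisible by all powers of [p], an
    additive map into [Z_p] is determined by its values on a family that spans
    modulo every power of [p] ([eq_on_p_spanning]).  Applied to [G] this says
    that the [phi_i] form a basis of [G^*p]; applied to [Z_p] itself, spanned by
    [1], it says that additive maps from [Z_p]-modules to [Z_p] are
    automatically linear.  So an element [u] of the double dual is known from
    the [p]-adic integers [u (phi_i)] ([double_dual_eq0]), and the isomorphism
    is [u |-> sum_i e_i (x) u (phi_i)] modulo [D].

    It is injective because each map [g (x) a |-> a * phi_j g] from the tensor
    product to [Z_p] kills the divisible subgroup and reads off [u (phi_j)].
    For surjectivity, and for the value at the image of [g], the point is that
    the errors [g (x) a - sum_i e_i (x) a * phi_i g] generate a divisible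
    subgroup ([coord_error_divisible]): they vanish on the [e_i], so that
    replacing [g] by its remainder modulo the span of the [e_i] divides the
    error by any power of [p], while an integer prime to [p] divides [a].  Hence
    [g (x) a] is, modulo [D], the image of the functional [f |-> a * f g].

    Continuity holds for every additive map, since it sends [p ^ n V] into
    [p ^ n W]. *)

Set Implicit Arguments.
Unset Strict Implicit.
Unset Printing Implicit Defensive.

Import GRing.Theory Num.Theory.
Local Open Scope ring_scope.
Local Open Scope quotient_scope.

(** * Arithmetic of p-adic integers *)

Section PadicIntegers.
Variable p : nat.
Hypothesis p_gt0 : (0 < p)%N.
Implicit Types x y : padic_int p.

Lemma expp_neq0 n : p%:Z ^+ n != 0.
Proof. by rewrite expf_neq0 // eqz_nat -lt0n. Qed.

Lemma padic_res_le x m n : (m <= n)%N -> (x n %% (p%:Z ^+ m))%Z = x m.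
Proof.
move=> /subnK <-; elim: (n - m)%N => [|k IHk]; first exact: padic_res_mod.
rewrite -[RHS]IHk addSn [x (k + m)%N]padic_resP; apply/esym/eqP.
rewrite eqz_mod_dvd.
have dvd_km : (p%:Z ^+ m %| p%:Z ^+ (k + m))%Z by rewrite dvdz_exp2l ?leq_addl.
apply: dvdz_trans dvd_km _.
by rewrite -eqz_mod_dvd modz_mod.
Qed.

Lemma padic_resMn x m n : (x *+ m) n = ((x n *+ m) %% (p%:Z ^+ n))%Z.
Proof.
elim: m => [|m IHm]; first by rewrite !mulr0n.
by rewrite !mulrS -modzDmr -IHm.
Qed.

Lemma padic_res_const (c : int) n :
  ((1 : padic_int p) *~ c) n = (c %% (p%:Z ^+ n))%Z.
Proof.
have resn (k : nat) : ((1 : padic_int p) *+ k) n = (k%:Z %% (p%:Z ^+ n))%Z.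
  rewrite padic_resMn /= -[LHS]modz_mod -mulr_natr modzMml mul1r modz_mod.
  by rewrite natz.
case: c => k; first by rewrite -pmulrn resn.
by rewrite NegzE mulrNz -pmulrn /= resn modzNm.
Qed.

(** The converse of [padic_resMn_exp]: the quotient has residues
    [x (n + k) / p ^ n], the shift making up for the digits lost by dividing. *)
Lemma padic_divp x n : x n = 0 -> exists y, x = y *+ (p ^ n)%N.
Proof.
move=> xn0; pose a k := (x (n + k)%N %/ (p%:Z ^+ n))%Z.
have aE k : a k * p%:Z ^+ n = x (n + k)%N.
  by apply: divzK; apply/dvdz_mod0P; rewrite padic_res_le ?leq_addr.
have ha k : (a k.+1 = a k %[mod p%:Z ^+ k])%Z.
  apply/eqP; rewrite eqz_mod_dvd -(dvdz_mul2r (expp_neq0 n)) mulrBl !aE.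
  by rewrite -exprD [(k + n)%N]addnC -eqz_mod_dvd addnS padic_res_eqm.
exists (padic_make ha); apply: padic_ext => k.
rewrite padic_resMn /= -mulr_natr natrX natz modzMml.
by rewrite aE padic_res_le ?leq_addl.
Qed.

Lemma padic_resMn_exp x n : (x *+ (p ^ n)%N) n = 0.
Proof.
by rewrite padic_resMn -mulr_natr natrX natz modzMl.
Qed.

Lemma padic_separated x :
  (forall n, exists y, x = y *+ (p ^ n)%N) -> x = 0.
Proof.
move=> hx; apply: padic_ext => n; have [y ->] := hx n.
by rewrite padic_resMn_exp /= mod0z.
Qed.

(** Integers prime to [p] are units of the p-adic integers: inverses modulo the
    powers of [p] are compatible because inverses modulo [p ^ n] are unique. *)
Lemma padic_div_coprime x m : coprime p m -> exists y, x = y *+ m.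
Proof.
move=> co_pm.
have co k : coprimez (p%:Z ^+ k) m%:Z.
  by apply: coprimezXl; rewrite coprimezE.
have inv k : exists u : int, (m%:Z * u = 1 %[mod p%:Z ^+ k])%Z.
  have [[v u] /= E] := coprimezP _ _ (co k).
  by exists u; rewrite -E mulrC modzMDl.
have [u uE] := choice inv.
have muE k : (m%:Z * (u k * x k) = x k %[mod p%:Z ^+ k])%Z.
  by rewrite mulrA -modzMml uE modzMml mul1r.
have ha k : (u k.+1 * x k.+1 = u k * x k %[mod p%:Z ^+ k])%Z.
  apply/eqP; rewrite eqz_mod_dvd -(Gauss_dvdzr _ (co k)) mulrBr.
  rewrite -eqz_mod_dvd muE -padic_res_eqm eqz_mod_dvd.
  have dvd_k : (p%:Z ^+ k %| p%:Z ^+ k.+1)%Z by rewrite dvdz_exp2l.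
  by apply: dvdz_trans dvd_k _; rewrite -eqz_mod_dvd muE.
exists (padic_make ha); apply: padic_ext => k.
by rewrite padic_resMn /= -mulr_natl natz modzMmr muE padic_res_mod.
Qed.

End PadicIntegers.

(** * Additive maps into the p-adic integers *)

(** Equivalently, the images of the [e i] in the [p]-adic completion of [A]
    generate a dense subgroup. *)
Definition p_spanning (p : nat) (A : zmodType) k (e : 'I_k -> A) : Prop :=
  forall n g, exists c : 'I_k -> int, exists h,
    g = \sum_i e i *~ c i + h *+ (p ^ n)%N.

(** Independence over [F_p] of the classes of the [e i] in [A / pA]. *)
Definition p_indep (p : nat) (A : zmodType) k (e : 'I_k -> A) : Prop :=
  forall (c : 'I_k -> int) h,
    \sum_i e i *~ c i = h *+ p -> forall i, (p %| c i)%Z.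

Section DualMaps.
Variable p : nat.
Hypothesis p_gt0 : (0 < p)%N.

(** The difference of the two maps vanishes on the span of [e], hence takes
    values divisible by every power of [p]. *)
Lemma eq_on_p_spanning (A : zmodType) k (e : 'I_k -> A) (f g : A^*[p]) :
  p_spanning p e -> (forall i, f (e i) = g (e i)) -> f =1 g.
Proof.
move=> span_e fg x; apply/eqP; rewrite -subr_eq0; apply/eqP.
apply: padic_separated => n; have [c [h ->]] := span_e n x.
exists (f h - g h); rewrite [in LHS](raddfD f) [in LHS](raddfD g).
rewrite !raddfMn mulrnBl opprD addrACA -[RHS]add0r; congr (_ + _).
rewrite (raddf_sum f) (raddf_sum g) -sumrB big1 // => i _.
by rewrite (raddfMz f) (raddfMz g) fg subrr.
Qed.

Lemma one_p_spanning : p_spanning p (fun _ : 'I_1 => 1 : padic_int p).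
Proof.
(* The residue [x n], taken as an integer, approximates [x] modulo [p ^ n]. *)
move=> n x; have : (x - (1 : padic_int p) *~ x n) n = 0.
  have -> : (x - (1 : padic_int p) *~ x n) n =
            ((x n + (- ((1 : padic_int p) *~ x n)%R) n) %% (p%:Z ^+ n))%Z by [].
  rewrite /= padic_res_const modzDmr -modzDmr modzNm modzDmr subrr.
  by rewrite mod0z.
move=> /(padic_divp p_gt0)[h hE]; exists (fun=> x n), h.
by rewrite big_ord1 -hE addrC subrK.
Qed.

(** Linearity comes for free: [f] and multiplication by [f 1] agree at [1],
    which spans the p-adic integers modulo every power of [p]. *)
Lemma additive_padic_linear (f : (padic_int p)^*[p]) a : f a = a * f 1.
Proof.
rewrite mulrC; apply: (@eq_on_p_spanning _ _ _ f (f 1 \*o idfun)).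
  exact: one_p_spanning.
by move=> i /=; rewrite mulr1.
Qed.

(** Every [f] is the combination of the [phi i] with coefficients [f (e i)], and
    [u] respects such combinations because [a |-> u (a * phi i)] is an additive
    endomorphism of the p-adic integers, hence linear. *)
Lemma double_dual_eq0 (A : zmodType) k (e : 'I_k -> A) (phi : 'I_k -> A^*[p])
    (u : A^*[p]^*[p]) :
    p_spanning p e -> (forall i j, phi i (e j) = (i == j)%:R) ->
  (forall i, u (phi i) = 0) -> u = 0.
Proof.
move=> span_e dual_e u0; apply: additive_ext => f.
have scale_add (g : A^*[p]) :
    zmod_morphism (fun a : padic_int p => a \*o g : A^*[p]).
  by move=> a b; apply: additive_ext => x /=; rewrite mulrBl.
pose scale (g : A^*[p]) : {additive padic_int p -> A^*[p]} :=
  HB.pack (fun a : padic_int p => a \*o g : A^*[p])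
    (GRing.isZmodMorphism.Build _ _ _ (scale_add g)).
have -> : f = \sum_i scale (phi i) (f (e i)).
  apply: additive_ext; apply: (eq_on_p_spanning span_e) => j.
  have ev : zmod_morphism (fun g : A^*[p] => g (e j)) by [].
  pose evj : {additive A^*[p] -> padic_int p} :=
    HB.pack (fun g : A^*[p] => g (e j)) (GRing.isZmodMorphism.Build _ _ _ ev).
  rewrite -[RHS]/(evj _) raddf_sum /= (bigD1 j) //= big1 => [|i ne_ij].
    by rewrite dual_e eqxx mulr1 addr0.
  by rewrite dual_e (negPf ne_ij) mulr0.
rewrite raddf_sum big1 // => i _.
rewrite -[LHS]/((u \o scale (phi i)) _) additive_padic_linear.
rewrite -[RHS](mulr0 (f (e i))) -(u0 i); congr (_ * u _).
by apply: additive_ext => x /=; rewrite mul1r.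
Qed.

(** The p-adic integers are reduced as an abelian group. *)
Lemma divisible_subgroup_padic (V : zmodType) (f : V^*[p]) v :
  v \in @divisible_subgroup V -> f v = 0.
Proof.
move=> Dv; apply: padic_separated => n.
have [|w _ <-] := divisible_subgroup_divisible _ Dv (n := (p ^ n)%N).
  by rewrite expn_gt0 p_gt0.
by exists (f w); rewrite raddfMn.
Qed.

End DualMaps.

(** * A basis modulo p and its dual coordinates *)

Lemma int_row_kernel m r (A : 'I_m -> 'I_r -> int) : (r < m)%N ->
  exists v : 'I_m -> int,
    (exists i, v i != 0) /\ forall j, \sum_i v i * A i j = 0.
Proof.
move=> lt_rm; pose B : 'M[rat]_(m, r) := \matrix_(i, j) (A i j)%:~R.
have : kermx B != 0.
  by rewrite kermx_eq0 -row_leq_rank -ltnNge (leq_ltn_trans (rank_leq_col B)).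
case/rowV0Pn=> w /sub_kermxP wB nz_w.
(* [v] is [w] times the product of all its denominators. *)
pose d (i : 'I_m) := \prod_(j | j != i) denq (w 0 j).
pose v i : int := numq (w 0 i) * d i.
have vE i : (v i)%:~R = (\prod_j denq (w 0 j))%:~R * w 0 i.
  rewrite (bigD1 i) //= -/(d i) !intrM mulrAC; congr (_ * _).
  by rewrite numqE mulrC.
exists v; split.
  have [j nz_j] : exists j, w 0 j != 0.
    by have /rV0Pn := nz_w.
  exists j; rewrite -(intr_eq0 rat) vE mulf_neq0 // intr_eq0.
  by apply/prodf_neq0 => i _; exact: denq_neq0.
move=> j; apply: (@intr_inj rat); rewrite rmorph_sum rmorph0 /=.
have := congr1 (fun M : 'rV_r => (\prod_j denq (w 0 j))%:~R * M 0 j) wB.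
rewrite !mxE mulr0 mulr_sumr => wB0; apply: etrans wB0.
apply: eq_bigr => i _.
by rewrite intrM vE mulrA !mxE.
Qed.

(** Steinitz bound over the integers.  Maximality of [s] gives each [e j] a
    nonzero multiple in the span of [s]; a relation between the rows of
    coefficients of these multiples is a relation between the [e j]. *)
Lemma leq_size_max_lin_indep (G : zmodType) (s : seq G) m (e : 'I_m -> G) :
  max_lin_indep s ->
  (forall c : 'I_m -> int, \sum_i e i *~ c i = 0 -> forall i, c i = 0) ->
  (m <= size s)%N.
Proof.
case=> indep_s max_s indep_e; rewrite leqNgt; apply/negP => lt_sm.
have dep j : exists na : int * ('I_(size s) -> int),
    na.1 != 0 /\ e j *~ na.1 = \sum_(i < size s) s`_i *~ na.2 i.
  have : ~ forall c : 'I_(size s).+1 -> int,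
      \sum_(i < (size s).+1) (e j :: s)`_i *~ c i = 0 -> forall i, c i = 0.
    exact: max_s.
  case/existsNP=> c /not_implyP[sum0 /existsNP[i nz_i]].
  rewrite big_ord_recl [(e j :: s)`_ord0]/= in sum0.
  exists (c ord0, fun i => - c (fintype.lift ord0 i)) => /=; split.
    apply: contra_notN nz_i => /eqP c0; move: sum0; rewrite c0 mulr0z add0r.
    move=> /indep_s cs; case: (unliftP ord0 i) => [i' ->|-> //].
    exact: cs.
  apply/eqP; rewrite -subr_eq0 -sumrN; apply/eqP; rewrite -[RHS]sum0.
  by congr (_ + _); apply: eq_bigr => i' _; rewrite mulrNz opprK.
have [na naP] := choice dep.
have [v [[j nz_j] vA]] := int_row_kernel (fun i => (na i).2) lt_sm.
suff /indep_e/(_ j)/eqP : \sum_i e i *~ (v i * (na i).1) = 0.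
  by rewrite mulf_eq0 (negPf nz_j) (negPf (naP j).1).
under eq_bigr => i _.
  rewrite mulrC mulrzA (naP i).2 mulrz_suml; over.
rewrite exchange_big big1 //= => i _.
transitivity (s`_i *~ (\sum_j v j * (na j).2 i)); last by rewrite vA mulr0z.
by rewrite mulrz_sumr; apply: eq_bigr => j' _; rewrite mulrC mulrzA.
Qed.

Section PBasis.
Variables (p : nat) (G : zmodType).
Hypotheses (p_prime : prime p) (tfG : torsion_free G).

Lemma torsion_free_mulrIn (g h : G) n : (0 < n)%N -> g *+ n = h *+ n -> g = h.
Proof.
move=> n_gt0 /eqP; rewrite -subr_eq0 -mulrnBl => /eqP /tfG[n0|/eqP].
  by rewrite n0 in n_gt0.
by rewrite subr_eq0 => /eqP.
Qed.

(** Independence modulo [p] lifts to [p ^ n]: once all coefficients are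
    divisible by [p], torsion-freeness lets the relation itself be divided by
    [p]. *)
Lemma p_indep_exp k (e : 'I_k -> G) n (c : 'I_k -> int) h :
  p_indep p e -> \sum_i e i *~ c i = h *+ (p ^ n)%N ->
  forall i, (p%:Z ^+ n %| c i)%Z.
Proof.
move=> indep_e; elim: n c => [|n IHn] c; first by move=> _ i; exact: dvd1z.
rewrite expnSr mulrnA => sumE.
have pc := indep_e _ _ sumE.
have cE i : c i = (c i %/ p)%Z * p by rewrite divzK.
move=> i; rewrite exprSr cE dvdz_mul2r; last by rewrite eqz_nat -lt0n prime_gt0.
apply: (IHn (fun i => (c i %/ p)%Z)).
apply: (torsion_free_mulrIn (prime_gt0 p_prime)); rewrite -sumE -sumrMnl.
by apply: eq_bigr => j _; rewrite [in RHS]cE mulrzA.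
Qed.

(** The coefficients of a relation are divisible by every power of [p]. *)
Lemma p_indep_lin_indep k (e : 'I_k -> G) : p_indep p e ->
  forall c : 'I_k -> int, \sum_i e i *~ c i = 0 -> forall i, c i = 0.
Proof.
move=> indep_e c sum0 i; pose n := `|c i|%N.
have : (p%:Z ^+ n %| c i)%Z.
  by apply: (p_indep_exp (h := 0) indep_e); rewrite mul0rn.
rewrite dvdzE abszX /= => dvd_pn; apply/eqP; rewrite -absz_eq0.
apply: contraLR dvd_pn; rewrite -lt0n => c_gt0.
by rewrite gtnNdvd // ltn_expl // prime_gt1.
Qed.

(** Spanning modulo [p] implies spanning modulo [p ^ n], by expanding the
    remainder again. *)
Lemma p_spanningP k (e : 'I_k -> G) :
    (forall g, exists c : 'I_k -> int, exists h,
       g = \sum_i e i *~ c i + h *+ p) ->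
  p_spanning p e.
Proof.
move=> span_e; elim=> [|n IHn] g.
  exists (fun=> 0), g; rewrite big1 ?add0r //.
have [c [h gE]] := IHn g; have [c' [h' hE]] := span_e h.
exists (fun i => c i + c' i * (p ^ n)%N), h'.
rewrite gE hE mulrnDl -mulrnA -expnS addrA; congr (_ + _).
rewrite -sumrMnl -big_split; apply: eq_bigr => i _ /=.
by rewrite mulrzDr mulrzA.
Qed.

(** Over [F_p], a maximal independent family spans: in a relation involving one
    more element [g], the coefficient of [g] is prime to [p], so it can be
    inverted modulo [p] by a Bezout relation. *)
Lemma maximal_p_indep_spanning k (e : 'I_k -> G) :
    p_indep p e ->
    (forall e' : 'I_k.+1 -> G, ~ p_indep p e') ->
  p_spanning p e.
Proof.
move=> indep_e max_k; apply: p_spanningP => g.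
pose e' (i : 'I_k.+1) := oapp e g (unlift ord0 i).
have /existsNP[c /existsNP[h]] := max_k e'.
case/not_implyP=> sumE /existsNP[i Ndvd_i].
move: sumE; rewrite big_ord_recl /e' unlift_none /=.
under eq_bigr do rewrite liftK /=.
move=> sumE; have Ndvd_0 : ~~ (p %| c ord0)%Z.
  apply/negP => /dvdzP[q cE]; apply: Ndvd_i.
  case: (unliftP ord0 i) => [j ->|->]; last by rewrite cE dvdz_mull.
  apply: (indep_e (fun j => c (fintype.lift ord0 j)) (h - g *~ q)).
  by rewrite mulrnBl -sumE cE mulrzA addrC addKr.
have : coprimez (c ord0) p.
  by rewrite coprimezE coprime_sym prime_coprime // -[p]/`|p%:Z|%N -dvdzE.
case/coprimezP=> -[u v] /= uv1.
(* Write [c_j] for the coefficients of the relation, [c_0] being that of [g].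
   Then [g = u c_0 g + p v g], and [c_0 g = p h - sum_j c_j e_j]. *)
exists (fun j => - c (fintype.lift ord0 j) * u), (h *~ u + g *~ v).
rewrite -[LHS]mulr1z -uv1 mulrzDr mulrnDl.
have -> : g *~ (v * p) = g *~ v *+ p by rewrite mulrzA.
rewrite addrA; congr (_ + _); rewrite [u * _]mulrC mulrzA.
have -> : h *~ u *+ p = h *+ p *~ u by rewrite !pmulrn -!mulrzA mulrC.
rewrite -sumE mulrzDl addrCA mulrz_suml -big_split big1 ?addr0 // => j _ /=.
by rewrite mulrzA mulrNz mulNrz addNr.
Qed.

Lemma exists_p_basis : finite_rank G ->
  exists k (e : 'I_k -> G), p_indep p e /\ p_spanning p e.
Proof.
case=> r [s [max_s _]].
pose P k := `[< exists e : 'I_k -> G, p_indep p e >].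
have exP : exists k, P k.
  by exists 0%N; apply/asboolP; exists (fun=> 0) => c h _ [].
have leP k : P k -> (k <= size s)%N.
  move=> /asboolP[e /p_indep_lin_indep indep_e].
  exact: leq_size_max_lin_indep max_s indep_e.
case: (ex_maxnP exP leP) => k /asboolP[e indep_e] max_k.
exists k, e; split=> //; apply: maximal_p_indep_spanning => // e' indep_e'.
suff : (k < k)%N by rewrite ltnn.
by apply: max_k; apply/asboolP; exists e'.
Qed.

(** The residue of [phi i g] modulo [p ^ n] is the [i]-th coefficient in any
    expansion of [g] modulo [p ^ n G].  These coefficients are unique modulo
    [p ^ n], which gives at once their compatibility as [n] varies, additivity
    in [g], and the values at the [e j]. *)
Lemma exists_dual_basis k (e : 'I_k -> G) : p_indep p e -> p_spanning p e ->
  exists phi : 'I_k -> G^*[p], forall i j, phi i (e j) = (i == j)%:R.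
Proof.
move=> indep_e span_e.
have uniq_coord n (c c' : 'I_k -> int) h h' :
    \sum_i e i *~ c i + h *+ (p ^ n)%N = \sum_i e i *~ c' i + h' *+ (p ^ n)%N ->
    forall i, (c i = c' i %[mod p%:Z ^+ n])%Z.
  move=> sumE i; apply/eqP; rewrite eqz_mod_dvd.
  apply: (p_indep_exp (c := fun i => c i - c' i) (h := h' - h) indep_e).
  under eq_bigr do rewrite mulrzBr.
  rewrite sumrB mulrnBl; apply/eqP; rewrite subr_eq addrAC eq_sym subr_eq.
  by rewrite addrC -sumE.
have [coord coordP] : {coord : nat * G -> 'I_k -> int & forall ng,
    exists h, ng.2 = \sum_i e i *~ coord ng i + h *+ (p ^ ng.1)%N}.
  have coord_ex ng := span_e ng.1 ng.2; exact: choice coord_ex.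
have compat i g n :
    (coord (n.+1, g) i = coord (n, g) i %[mod p%:Z ^+ n])%Z.
  have [h /= gE] := coordP (n, g); have [h' /= gE'] := coordP (n.+1, g).
  apply: (@uniq_coord n _ _ (h' *+ p) h).
  by rewrite -gE -mulrnA -expnS -gE'.
pose phi_fun i g := padic_make (compat i g).
have phi_add i : zmod_morphism (phi_fun i).
  move=> g g'; apply: padic_ext => n /=.
  rewrite modzNm modzDm.
  have [h /= gE] := coordP (n, g); have [h' /= gE'] := coordP (n, g').
  have [h'' /= gE''] := coordP (n, g - g').
  apply: (@uniq_coord n _ (fun i => coord (n, g) i - coord (n, g') i) h''
    (h - h')).
  rewrite -gE'' [in LHS]gE [in LHS]gE' opprD addrACA mulrnBl -sumrB.
  by congr (_ + _); apply: eq_bigr => i' _; rewrite mulrzBr.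
exists (fun i => HB.pack_for G^*[p] (phi_fun i)
  (GRing.isZmodMorphism.Build _ _ _ (phi_add i))) => i j /=.
apply: padic_ext => n; have [h /= eE] := coordP (n, e j).
transitivity ((((i == j) : nat)%:Z) %% (p%:Z ^+ n))%Z; last first.
  by case: (i == j) => /=; rewrite ?mod0z.
apply: (@uniq_coord n _ (fun i => ((i == j) : nat)%:Z) h 0).
rewrite -eE mul0rn addr0 (bigD1 j) //= eqxx mulr1z big1 ?addr0 //.
by move=> i' /negPf->; rewrite mulr0z.
Qed.

End PBasis.

(** * The tensor product *)

Section TensorProduct.
Variables A B : zmodType.

Lemma quot_eq0 (V : zmodType) (S : zmodClosed V) (x : V) :
  (\pi_(Quotient.quot S) x == 0) = (x \in S).
Proof. by rewrite -[x in RHS]subr0 Quotient.idealrBE raddf0. Qed.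

Lemma generated_subgroup_sub (V : zmodType) (X : set V) x :
  X x -> x \in generated_subgroup X.
Proof. by move=> Xx; apply/asboolP => S _ XS; exact: XS. Qed.

Lemma tensDl (a a' : A) (b : B) : tens (a + a') b = tens a b + tens a' b.
Proof.
apply/eqP; rewrite -subr_eq0 opprD addrA -!raddfB quot_eq0.
by apply: generated_subgroup_sub; left; exists a, a', b.
Qed.

Lemma tensDr (a : A) (b b' : B) : tens a (b + b') = tens a b + tens a b'.
Proof.
apply/eqP; rewrite -subr_eq0 opprD addrA -!raddfB quot_eq0.
by apply: generated_subgroup_sub; right; exists a, b, b'.
Qed.

Lemma tens_is_zmod_morphism (a : A) : zmod_morphism (@tens A B a).
Proof.
by move=> b b'; rewrite -[in RHS](subrK b' b) [in RHS]tensDr addrK.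
Qed.

HB.instance Definition _ (a : A) :=
  GRing.isZmodMorphism.Build B (tensor A B) (@tens A B a)
    (tens_is_zmod_morphism a).

Definition tensl (b : B) (a : A) : tensor A B := tens a b.

Lemma tensl_is_zmod_morphism (b : B) : zmod_morphism (tensl b).
Proof.
by move=> a a'; rewrite -[in RHS](subrK a' a) /tensl [in RHS]tensDl addrK.
Qed.

HB.instance Definition _ (b : B) :=
  GRing.isZmodMorphism.Build A (tensor A B) (tensl b)
    (tensl_is_zmod_morphism b).

Lemma tensMnr (a : A) (b : B) n : tens a (b *+ n) = tens a b *+ n.
Proof. exact: raddfMn. Qed.

Lemma tensMzl (a : A) (b : B) n : tens (a *~ n) b = tens a b *~ n.
Proof. exact: (raddfMz (tensl b)). Qed.

Lemma tensor_ind (S : {pred tensor A B}) :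
  zmod_closed S -> (forall a b, tens a b \in S) -> forall t, t \in S.
Proof.
move=> [S0 SB] tS t; rewrite -[t]reprK -[repr t]freeg_sumE raddf_sum /=.
have SD x y : x \in S -> y \in S -> x + y \in S.
  by move=> Sx Sy; rewrite -[y]opprK -[- y]sub0r !SB.
(* An integer coefficient is absorbed into the first factor. *)
elim/big_ind: _ => // -[a b] _; rewrite -[coeff _ _]intz -freegU_mulz raddfMz.
by rewrite -[_ *~ _]tensMzl.
Qed.

(** The universal property.  The target is viewed as a module over the integers,
    so that the free abelian group on pairs maps to it. *)
Lemma tensor_lift (C : zmodType) (beta : A -> B -> C) :
    (forall b, zmod_morphism (beta^~ b)) ->
    (forall a, zmod_morphism (beta a)) ->
  exists F : {additive tensor A B -> C}, forall a b, F (tens a b) = beta a b.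
Proof.
move=> betal betar.
pose F0 : {additive {freeg (A * B)} -> zmodule C} :=
  HB.pack (fglift (fun x => beta x.1 x.2 : zmodule C))
   (GRing.isZmodMorphism.Build _ _ _
     (lift_is_additive (fun x => beta x.1 x.2 : zmodule C))).
have F0U a b : F0 << (a, b) >> = beta a b by rewrite /= liftU scale1r.
have F0_rel r : r \in generated_subgroup (@bilinear_relations A B) -> F0 r = 0.
  move=> /asboolP/(_ [pred r | F0 r == 0]) /(_ _ _)/eqP; apply.
    split=> [|x y]; rewrite !inE ?raddf0 // => /eqP x0 /eqP y0.
    by rewrite raddfB x0 y0 subrr.
  move=> x [[a [a' [b ->]]]|[a [b [b' ->]]]]; rewrite inE !(raddfB F0) !F0U.
    by have := betal b (a + a') a'; rewrite addrK => ->; rewrite subKr subrr.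
  by have := betar a (b + b') b'; rewrite addrK => ->; rewrite subKr subrr.
pose F (t : tensor A B) : C := F0 (repr t).
have F_pi D : F (\pi_(tensor A B) D) = F0 D.
  apply/eqP; rewrite -subr_eq0; apply/eqP.
  rewrite -[LHS](raddfB F0); apply: F0_rel.
  by rewrite Quotient.idealrBE reprK.
have F_add : zmod_morphism F.
  by elim/quotW=> x; elim/quotW=> y; rewrite -raddfB !F_pi; exact: raddfB.
exists (HB.pack_for {additive tensor A B -> C} F
  (GRing.isZmodMorphism.Build _ _ _ F_add)) => a b.
by rewrite -F0U -F_pi.
Qed.

End TensorProduct.

(** * The isomorphism *)

Lemma mod_div_eq0 (V : zmodType) (v : V) :
  (\pi_(mod_div V) v == 0) = (v \in @divisible_subgroup V).
Proof. exact: quot_eq0. Qed.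

(** An additive map sends [p ^ n V] into [p ^ n W]. *)
Lemma additive_padic_continuous (p : nat) (V W : zmodType)
    (f : {additive V -> W}) :
  continuous (f : padic_space p V -> padic_space p W).
Proof.
move=> x U [W' [openW' W'fx sub_W'U]].
exists (f @^-1` W')%classic; split=> // [y W'fy|y W'fy]; last exact: sub_W'U.
have [n W'n] := openW' (f y) W'fy; exists n => v.
by rewrite /preimage /= raddfD raddfMn; exact: W'n.
Qed.

Lemma inj_surj_bij (A B : Type) (f : A -> B) :
  injective f -> (forall y, exists x, f x = y) -> bijective f.
Proof.
move=> inj_f /choice[g fg].
by exists g => // x; apply: inj_f; rewrite fg.
Qed.

Section Coordinates.
Variables (p : nat) (G : zmodType) (k : nat) (e : 'I_k -> G).
Variable phi : 'I_k -> G^*[p].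
Hypotheses (p_prime : prime p) (span_e : p_spanning p e).
Hypothesis dual_e : forall i j, phi i (e j) = (i == j)%:R.

Let M : zmodType := tensor G (padic_int p).
Let p_gt0 : (0 < p)%N := prime_gt0 p_prime.

Definition coord_error (g : G) (a : padic_int p) : M :=
  tens g a - \sum_i tens (e i) (a * phi i g).

Lemma coord_error_basis j a : coord_error (e j) a = 0.
Proof.
rewrite /coord_error (bigD1 j) //= dual_e eqxx mulr1 opprD addrA subrr sub0r.
rewrite big1 ?oppr0 // => i ne_ij.
by rewrite dual_e (negPf ne_ij) mulr0 raddf0.
Qed.

Lemma coord_error_is_zmod_morphism a : zmod_morphism (coord_error^~ a).
Proof.
move=> g h; rewrite /coord_error.
have -> : \sum_i tens (e i) (a * phi i (g - h)) =
  \sum_i tens (e i) (a * phi i g) - \sum_i tens (e i) (a * phi i h).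
  by rewrite -sumrB; apply: eq_bigr => i _; rewrite raddfB mulrBr raddfB.
rewrite [tens (g - h) a](raddfB (tensl a)) !opprB addrACA [RHS]addrACA.
by rewrite [- _ - _]addrC.
Qed.

Lemma coord_errorMn g a n : coord_error g (a *+ n) = coord_error g a *+ n.
Proof.
rewrite /coord_error tensMnr mulrnBl -sumrMnl; congr (_ - _).
by apply: eq_bigr => i _; rewrite mulrnAl tensMnr.
Qed.

(** The subgroup generated by all errors is divisible.  To divide the error of
    [h] and [b] by [n = m * p ^ v] with [m] prime to [p], write [b = m b'] and
    expand [h] modulo [p ^ v G]: the basis part has no error, and the remainder
    [p ^ v h'] contributes [p ^ v] times the error of [h']. *)
Lemma coord_error_divisible g a :
  coord_error g a \in @divisible_subgroup M.
Proof.
pose X : set M := fun t => exists g a, t = coord_error g a.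
have XE g' a' : coord_error g' a' \in generated_subgroup X.
  by apply: generated_subgroup_sub; exists g', a'.
apply: divisible_subgroup_max (XE g a).
  exact: generated_subgroup_zmod_closed.
move=> n x n_gt0 /asboolP genx.
(* The multiples by [n] form a subgroup, so only the generators matter. *)
pose S : {pred M} :=
  fun x => `[< exists2 y, y \in generated_subgroup X & y *+ n = x >].
apply/asboolP; apply: (genx S).
  split; first by apply/asboolP; exists 0; rewrite ?rpred0 ?mul0rn.
  move=> _ _ /asboolP[y Xy <-] /asboolP[y' Xy' <-]; apply/asboolP.
  by exists (y - y'); rewrite ?rpredB // mulrnBl.
move=> _ [h [b ->]]; apply/asboolP.
have [m co_pm nE] := pfactor_coprime p_prime n_gt0.
have [b' bE] := padic_div_coprime b co_pm.
have [c [h' hE]] := span_e (logn p n) h.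
exists (coord_error h' b'); first exact: XE.
have -> : coord_error h b = coord_error h b' *+ m by rewrite bE coord_errorMn.
rewrite nE mulnC mulrnA; congr (_ *+ _).
pose err : {additive G -> M} := HB.pack (coord_error^~ b')
  (GRing.isZmodMorphism.Build _ _ _ (coord_error_is_zmod_morphism b')).
rewrite -[RHS]/(err h) hE raddfD raddfMn raddf_sum big1 ?add0r // => i _.
by rewrite raddfMz /= coord_error_basis mul0rz.
Qed.

Definition double_dual_map_fun (u : G^*[p]^*[p]) : mod_div M :=
  \pi_(mod_div M) (\sum_i tens (e i) (u (phi i))).

Lemma double_dual_map_is_zmod_morphism : zmod_morphism double_dual_map_fun.
Proof.
move=> u v; rewrite /double_dual_map_fun -raddfB -sumrB; congr (\pi _).
by apply: eq_bigr => i _; rewrite -raddfB.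
Qed.

HB.instance Definition _ :=
  GRing.isZmodMorphism.Build G^*[p]^*[p] (mod_div M) double_dual_map_fun
    double_dual_map_is_zmod_morphism.

Definition double_dual_map : {additive G^*[p]^*[p] -> mod_div M} :=
  double_dual_map_fun.

(** Among the functionals [f |-> a * f g] are the evaluations ([a = 1]); their
    images generate the target. *)
Lemma double_dual_map_scaled_hat g a (u : G^*[p]^*[p]) :
  (forall f, u f = a * f g) -> double_dual_map u = \pi_(mod_div M) (tens g a).
Proof.
move=> uE; apply/eqP; rewrite eq_sym -subr_eq0 -raddfB mod_div_eq0.
under eq_bigr do rewrite uE.
exact: coord_error_divisible.
Qed.

(** The [j]-th coordinate of the image is recovered by the map
    [tens g b |-> b * phi j g], which is well defined modulo divisible
    elements. *)
Lemma double_dual_map_inj : injective double_dual_map.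
Proof.
apply: raddf_inj => u /eqP; rewrite mod_div_eq0 => Du.
apply: (double_dual_eq0 p_gt0 span_e dual_e) => j.
have betal (b : padic_int p) : zmod_morphism (fun g : G => b * phi j g).
  by move=> g h; rewrite raddfB mulrBr.
have betar (g : G) : zmod_morphism (fun b : padic_int p => b * phi j g).
  by move=> b b'; rewrite mulrBl.
have [F FE] := tensor_lift betal betar.
rewrite -[RHS](divisible_subgroup_padic p_gt0 F Du) raddf_sum (bigD1 j) //=.
rewrite FE dual_e eqxx mulr1 big1 ?addr0 // => i ne_ij.
by rewrite FE dual_e eq_sym (negPf ne_ij) mulr0.
Qed.

Lemma double_dual_map_surj y : exists u, double_dual_map u = y.
Proof.
elim/quotW: y => t.
pose S : {pred M} :=
  fun t => `[< exists u, double_dual_map u = \pi_(mod_div M) t >].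
apply/asboolP; rewrite -[asbool _]/(t \in S).
apply: tensor_ind => [|g a].
  split=> [|t1 t2 /asboolP[u uE] /asboolP[v vE]]; apply/asboolP.
    by exists 0; rewrite !raddf0.
  by exists (u - v); rewrite !raddfB uE vE.
apply/asboolP; have add_u : zmod_morphism (fun f : G^*[p] => a * f g).
  by move=> f f'; rewrite -mulrBr.
exists (HB.pack_for G^*[p]^*[p] (fun f : G^*[p] => a * f g)
  (GRing.isZmodMorphism.Build _ _ _ add_u)).
exact: double_dual_map_scaled_hat.
Qed.

End Coordinates.

Theorem theorem3p1 (p : nat) (G : zmodType) :
  prime p -> torsion_free G -> finite_rank G ->
  exists f : {additive G^*[p]^*[p] -> mod_div (tensor G (padic_int p))},
    [/\ bijective f,
        continuous (f : padic_space p G^*[p]^*[p] ->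
                        padic_space p (mod_div (tensor G (padic_int p)))) &
        forall g : G,
          f (hat p g) = \pi_(mod_div (tensor G (padic_int p))) (tens g 1)].
Proof.
move=> p_prime tfG frG.
have [k [e [indep_e span_e]]] := exists_p_basis p_prime tfG frG.
have [phi dual_e] := exists_dual_basis p_prime tfG indep_e span_e.
exists (double_dual_map e phi); split.
- apply: inj_surj_bij; first exact: double_dual_map_inj.
  exact: double_dual_map_surj.
- exact: additive_padic_continuous.
- move=> g; apply: double_dual_map_scaled_hat => // f.
  by rewrite mul1r.
Qed.
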